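(* Let $(X,\mathcal{D})$ be a diffeological space. There exists a one-to-one correspondence between the set of weak Riemannian metrics $g\colon T_2(X)\to\mathbb{R}$ and the set of symmetric and positive covariant $2$-tensors on $X$ in the sense of Iglesias-Zemmour.
   Context: A domain is an open subset of some $\mathbb{R}^n$, $n\ge 0$. A diffeology $\mathcal{D}$ on a set $X$ is a set of maps $P\colon U_P\to X$ from domains (called plots) that contains all constant maps from domains, is closed under precomposition with smooth maps between domains, and is local (a map $U\to X$ from a domain whose restrictions to the members of some open cover of $U$ are plots is a plot). A map between diffeological spaces is smooth if its composite with every plot is a plot. Domains carry the standard diffeology of all usual smooth maps from domains. Tangent construction: regard $\mathcal{D}$ as a category whose objects are plots and whose morphisms $P\to Q$ are smooth $h\colon U_P\to U_Q$ with $Q\circ h=P$. Put $T_2(X)=\operatorname{colim}_{P\in\mathcal{D}}(U_P\times\mathbb{R}^{\dim U_P}\times\mathbb{R}^{\dim U_P})$ (colimit in diffeological spaces), where $h$ acts by $(r,v,w)\mapsto(h(r),Jh_rv,Jh_rw)$ with $Jh$ the Jacobian matrix; $[r,v,w]_P$ is the class of $(r,v,w)$. A weak Riemannian metric on $X$ is a map $g\colon T_2(X)\to\mathbb{R}$ such that for every plot $P$, $g(P)_r(v,w):=g([r,v,w]_P)$ is a smooth symmetric covariant $2$-tensor on $U_P$ which is positive: $g(P)_r(v,v)\ge 0$ for all $r\in U_P$, $v\in T_rU_P$. A covariant $k$-tensor on $X$ in the sense of Iglesias-Zemmour is a family $\nu=\{\nu(P)\}_{P\in\mathcal{D}}$,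 with $\nu(P)$ a smooth covariant $k$-tensor on the domain $U_P$, which is natural: $\nu(P\circ f)=f^*(\nu(P))$ for every plot $P$ and every smooth map $f\colon V\to U_P$ from a domain $V$. A covariant $2$-tensor $\nu$ is symmetric if each $\nu(P)$ is symmetric; it is positive if $\nu(\gamma)_t(1,1)\ge 0$ for every smooth path $\gamma\colon\mathbb{R}\to X$ and every $t\in\mathbb{R}$, where $1=(d/dt)_t$ is the canonical basis vector of $T_t\mathbb{R}$. *)

(* Defs.v *)
From mathcomp Require Import all_boot all_order all_algebra.
From mathcomp Require Import all_classical all_reals all_analysis.
From Stdlib Require Import Relation_Operators.

Set Implicit Arguments.
Unset Strict Implicit.
Unset Printing Implicit Defensive.

Import Order.TTheory GRing.Theory Num.Theory.
Import numFieldNormedType.Exports.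

Local Open Scope classical_set_scope.
Local Open Scope ring_scope.

Section Smoothness.
Context {R : realType}.

(* For open [U], [classC k U f] says that [f] is of class C^k on [U]: the
   recursion runs over all iterated directional derivatives. *)
Fixpoint classC (W : normedModType R) n k (U : set 'rV[R]_n)
    (f : 'rV[R]_n -> W) : Prop :=
  match k with
  | 0%N => forall x, U x -> {for x, continuous f}
  | k'.+1 => (forall x, U x -> differentiable f x) /\
             forall v : 'rV[R]_n, classC k' U ('D_v f)
  end.

Definition smooth_on (W : normedModType R) n (U : set 'rV[R]_n)
  (f : 'rV[R]_n -> W) := forall k, classC k U f.

Section Algebra.
Variable n : nat.
Implicit Types (U : set 'rV[R]_n).

Lemma classC_sub (W : normedModType R) k U U' (f : 'rV[R]_n -> W) :
  U' `<=` U -> classC k U f -> classC k U' f.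
Proof.
move=> UU; elim: k f => [|k IH] f /=; first by move=> h x /UU/h.
by case=> d h; split=> [x /UU/d //|v]; apply: IH.
Qed.

Lemma classCS (W : normedModType R) k U (f : 'rV[R]_n -> W) :
  classC k.+1 U f -> classC k U f.
Proof.
elim: k f => [|k IH] f; first by case=> d _ x /d/differentiable_continuous.
by case=> d h; split=> // v; apply: IH; exact: h.
Qed.

Lemma near_eq_differentiable (W : normedModType R) (f g : 'rV[R]_n -> W) x :
  (\forall y \near x, f y = g y) -> differentiable f x -> differentiable g x.
Proof.
move=> fg /diff_locallyP[c h].
have H : g \o shift x = cst (g x) + 'd f x +o_ 0 id.
  apply/eqaddoP => e e0; move: h => /eqaddoP/(_ e e0) h.
  rewrite -(nbhs_singleton fg).
  have fg0 : \forall y \near 0, f (y + x) = g (y + x).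
    by move: fg; rewrite (near_shift 0)/= subr0.
  near=> y; rewrite /= !fctE /= -(near fg0 y)//.
  by near: y; move: h; rewrite !fctE.
have dE : ('d g x : _ -> _) = 'd f x by exact: diff_unique.
by apply/diff_locallyP; rewrite dE.
Unshelve. all: by end_near. Qed.

Lemma classC_eq (W : normedModType R) k U (f g : 'rV[R]_n -> W) :
  open U -> (forall x, U x -> f x = g x) -> classC k U f -> classC k U g.
Proof.
move=> oU; have nearU (W0 : normedModType R) (a b : 'rV[R]_n -> W0) x :
    (forall x, U x -> a x = b x) -> U x -> \forall y \near x, a y = b y.
  by move=> ab Ux; near=> y; apply: ab; near: y; exact: open_nbhs_nbhs.
elim: k f g => [|k IH] f g fg.
  move=> hf x Ux; rewrite /prop_for /continuous_at -fg//; move: (hf x Ux).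
  apply: cvg_trans; apply: (@near_eq_cvg _ _ (nbhs x)); apply: nearU => // y /fg.
case=> d h; split=> [x Ux|v].
  by apply: near_eq_differentiable (d x Ux); exact: nearU.
apply: IH (h v) => x Ux; apply: near_eq_derive; exact: nearU.
Unshelve. all: by end_near. Qed.

Lemma smooth_on_eq (W : normedModType R) U (f g : 'rV[R]_n -> W) :
  open U -> (forall x, U x -> f x = g x) -> smooth_on U f -> smooth_on U g.
Proof. by move=> oU fg h k; exact: classC_eq (h k). Qed.

Lemma classC_cst (W : normedModType R) k U (c : W) :
  classC k U (fun _ : 'rV[R]_n => c).
Proof.
elim: k c => [|k IH] c /=; first by move=> x _; exact: cst_continuous.
split=> [x _|v]; first exact: differentiable_cst.
rewrite (_ : 'D_v _ = fun=> 0); first exact: IH.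
by apply/funext => x; rewrite (derive_cst c).
Qed.

Lemma classC_add (W : normedModType R) k U (f g : 'rV[R]_n -> W) : open U ->
  classC k U f -> classC k U g -> classC k U (f + g).
Proof.
move=> oU; elim: k f g => [|k IH] f g /=.
  by move=> hf hg x Ux; apply: continuousD; [exact: hf|exact: hg].
case=> df hf [dg hg]; split=> [x Ux|v].
  by apply: differentiableD; [exact: df|exact: dg].
apply: classC_eq (IH _ _ (hf v) (hg v)) => // x Ux.
by rewrite deriveD//; apply: diff_derivable; [exact: df|exact: dg].
Qed.

Lemma classC_mul k U (f g : 'rV[R]_n -> R) : open U ->
  classC k U f -> classC k U g -> classC k U (f * g).
Proof.
move=> oU; elim: k f g => [|k IH] f g.
  by move=> hf hg x Ux; apply: continuousM; [exact: hf|exact: hg].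
move=> hf hg; have [df hf'] := hf; have [dg hg'] := hg.
split=> [x Ux|v]; first by apply: differentiableM; [exact: df|exact: dg].
apply: (@classC_eq _ _ _ (f * 'D_v g + g * 'D_v f)) => //.
  by move=> x Ux; rewrite deriveM//; apply: diff_derivable; [exact: df|exact: dg].
by apply: classC_add => //; apply: IH; do ?[exact: classCS|exact: hf'|exact: hg'].
Qed.

Lemma classC_sum (W : normedModType R) k U m (f : 'I_m -> 'rV[R]_n -> W) :
  open U -> (forall i, classC k U (f i)) -> classC k U (\sum_i f i).
Proof.
move=> oU h; apply: (big_ind (classC k U)) => //; first exact: classC_cst.
by move=> *; exact: classC_add.
Qed.

Lemma classC_coordP k U m (f : 'rV[R]_n -> 'rV[R]_m) : open U ->
  classC k U f <-> forall i, classC k U (fun x => f x 0 i : R).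
Proof.
move=> oU; elim: k f => [|k IH] f.
  split=> /= [h i x Ux|h x Ux].
    apply: (@continuous_comp _ _ _ f (fun y : 'rV_m => y 0 i)).
      exact: h.
    exact: coord_continuous.
  apply/(@cvgrPdist_le _ _ _ (nbhs x)) => e e0.
  apply: (@filterS _ (nbhs x) _
      [set y | forall i, `|f x 0 i - f y 0 i| <= e]).
    move=> y hy; rewrite /Num.Def.normr/= mx_normrE.
    rewrite (bigmax_le _ (ltW e0))//= => -[a b] _.
    by rewrite !mxE (ord1 a).
  suff : \forall y \near nbhs x, forall i, `|f x 0 i - f y 0 i| <= e by [].
  apply: filter_forall => i.
  by have /(@cvgrPdist_le _ _ _ (nbhs x))/(_ e e0) := h i x Ux.
split=> [[d h] i|h].
  split=> [x Ux|v].
    apply: (@differentiable_comp _ _ _ _ f (fun y : 'rV_m => y 0 i : R)).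
      exact: d.
    exact: differentiable_coord.
  have /IH/(_ i) := h v; apply: classC_eq => // x Ux.
  by rewrite derive_mx ?mxE//; apply: diff_derivable; exact: d.
have fE : f = \sum_i (fun x => f x 0 i *: (delta_mx 0 i : 'rV[R]_m)).
  by apply/funext => x; rewrite fct_sumE -row_sum_delta.
have df x : U x -> differentiable f x.
  move=> Ux; rewrite fE; apply: differentiable_sum => i.
  by apply: differentiableZl; have [/(_ x Ux)] := h i.
split=> // v; apply/IH => i; have [_ /(_ v)] := h i.
apply: classC_eq => // x Ux.
by rewrite derive_mx ?mxE//; apply: diff_derivable; exact: df.
Qed.

Lemma classC_id k U : classC k U (id : 'rV[R]_n -> 'rV[R]_n).
Proof.
case: k => [|k]; first by move=> x _.
split=> [x _|v]; first exact: ex_diff.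
rewrite (_ : 'D_v id = fun=> v); first exact: classC_cst.
by apply/funext => x; rewrite derive_id.
Qed.

End Algebra.

Lemma classC_comp k n m p (U : set 'rV[R]_n) (V : set 'rV[R]_m)
    (f : 'rV[R]_n -> 'rV[R]_m) (g : 'rV[R]_m -> 'rV[R]_p) :
  open U -> open V -> (forall x, U x -> V (f x)) ->
  classC k U f -> classC k V g -> classC k U (g \o f).
Proof.
move=> oU oV UV hf hg; apply/classC_coordP => // i.
have {}hg := (classC_coordP _ _ oV).1 hg i.
change (classC k U ((fun y => g y 0 i : R) \o f)).
move: (fun y => _) hg => {i} {}g hg.
elim: k g hf hg => [|k IH] g hf hg.
  move=> x Ux; apply: (@continuous_comp _ _ _ f g); first exact: hf.
  by apply: hg; exact: UV.
have [df hf'] := hf; have [dg hg'] := hg.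
split=> [x Ux|v].
  apply: (@differentiable_comp _ _ _ _ f g); first exact: df.
  by apply: dg; exact: UV.
pose F (i : 'I_m) : 'rV[R]_n -> R :=
  (fun x => 'D_v f x 0 i : R) * ('D_(delta_mx 0 i) g \o f).
apply: (@classC_eq _ _ _ _ (\sum_i F i)) => //.
  move=> x Ux; have dfx := df x Ux; have dgx := dg _ (UV x Ux).
  rewrite [RHS]deriveE; last exact: (@differentiable_comp _ _ _ _ f g).
  rewrite diff_comp//= -(deriveE v dfx).
  rewrite [in RHS](row_sum_delta ('D_v f x)) linear_sum fct_sumE.
  by apply: eq_bigr => i _; rewrite linearZ /= -deriveE.
apply: classC_sum => // i; apply: classC_mul => //.
  exact: ((classC_coordP _ _ oU).1 (hf' v) i).
by apply: IH; [exact: classCS|exact: hg'].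
Qed.


Lemma classC_local (W : normedModType R) n k (U : set 'rV[R]_n)
    (f : 'rV[R]_n -> W) :
  (forall x, U x -> exists2 A : set 'rV[R]_n, A x & classC k A f) ->
  classC k U f.
Proof.
elim: k f => [|k IH] f h; first by move=> x /h[A Ax hA]; exact: hA.
split=> [x /h[A Ax [dA _]]|v]; first exact: dA.
by apply: IH => x /h[A Ax [_ hA]]; exists A => //; exact: hA.
Qed.

Lemma smooth_on_id n (U : set 'rV[R]_n) : smooth_on U (id : _ -> 'rV[R]_n).
Proof. by move=> k; exact: classC_id. Qed.

Lemma smooth_on_comp n m p (U : set 'rV[R]_n) (V : set 'rV[R]_m)
    (f : 'rV[R]_n -> 'rV[R]_m) (g : 'rV[R]_m -> 'rV[R]_p) :
  open U -> open V -> (forall x, U x -> V (f x)) ->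
  smooth_on U f -> smooth_on V g -> smooth_on U (g \o f).
Proof. by move=> oU oV UV hf hg k; exact: classC_comp (hf k) (hg k). Qed.

End Smoothness.

Section Domains.
Context (R : realType).

Record domain n := Domain {
  dom_set :> set 'rV[R]_n;
  dom_open : open dom_set }.

Definition full_domain n := Domain (@openT 'rV[R]_n).

Definition inclusion n (V U : domain n) (VU : V `<=` U) (x : V) : U :=
  exist _ (val x) (mem_set (VU _ (set_mem (valP x)))).

(* Differential calculus in the library is about total functions, so a map on
   a domain is extended by 0; values outside the open set are irrelevant. *)
Definition extend n (W : normedModType R) (U : domain n) (f : U -> W) :
    'rV[R]_n -> W :=
  fun x => oapp f 0 (insub x).

Definition smooth_map n (W : normedModType R) (U : domain n) (f : U -> W) :=
  smooth_on U (extend f).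

Definition smooth_between n m (V : domain n) (U : domain m) (f : V -> U) :=
  smooth_map (fun s => val (f s) : 'rV[R]_m).

(* [v *m Jac f s] is the Jacobian matrix of [f] at [s] applied to the tangent
   vector [v] (vectors are rows). *)
Definition Jac n m (V : domain n) (U : domain m) (f : V -> U) (s : V) :
    'M[R]_(n, m) :=
  'J (extend (fun x => val (f x) : 'rV[R]_m)) (val s).

Lemma extendE n (W : normedModType R) (U : domain n) (f : U -> W) (x : U) :
  extend f (val x) = f x.
Proof. by rewrite /extend valK. Qed.

Lemma domP n (U : domain n) (x : 'rV[R]_n) :
  dom_set U x -> exists u : U, x = val u.
Proof. by move=> Ux; exists (exist _ x (mem_set Ux)). Qed.

Lemma dom_val n (U : domain n) (u : U) : dom_set U (val u).
Proof. exact: set_mem (valP u). Qed.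

Lemma smooth_map_eq n (W : normedModType R) (U : domain n) (f : U -> W)
    (F : 'rV[R]_n -> W) :
  (forall u : U, f u = F (val u)) -> smooth_on U F -> smooth_map f.
Proof.
move=> fF; apply: smooth_on_eq; first exact: dom_open.
by move=> _ /domP[u ->]; rewrite extendE fF.
Qed.

Lemma smooth_map_cst n (W : normedModType R) (U : domain n) (c : W) :
  smooth_map (fun _ : U => c).
Proof. by apply: (@smooth_map_eq _ _ _ _ (fun=> c)) => // k; exact: classC_cst. Qed.

Lemma smooth_map_comp n m p (U : domain n) (V : domain m)
    (f : U -> V) (g : V -> 'rV[R]_p) :
  smooth_between f -> smooth_map g -> smooth_map (g \o f).
Proof.
move=> hf hg.
apply: (@smooth_map_eq _ _ _ _ (extend g \o extend (fun s => val (f s)))).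
  by move=> u; rewrite /= !extendE.
apply: smooth_on_comp hf hg; [exact: dom_open|exact: dom_open|].
by move=> _ /domP[u ->]; rewrite extendE; exact: dom_val.
Qed.

Lemma smooth_map_local n (W : normedModType R) (U : domain n) (f : U -> W)
    (C : set (domain n)) (CU : forall A, C A -> A `<=` U) :
  \bigcup_(A in C) (A : set _) = U ->
  (forall A (CA : C A), smooth_map (f \o inclusion (CU A CA))) ->
  smooth_map f.
Proof.
move=> covU h k; apply: classC_local => x; rewrite -covU => -[A CA Ax].
exists A => //; apply: classC_eq (h A CA k); first exact: dom_open.
move=> _ /domP[u ->]; rewrite extendE /=.
by rewrite -[in RHS](_ : val (inclusion (CU A CA) u) = val u)// extendE.
Qed.

End Domains.

Section Diffeology.
Context (R : realType).

Record diffeology (X : Type) := Diffeology {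
  is_plot : forall n (U : domain R n), (U -> X) -> Prop;
  is_plot_cst : forall n (U : domain R n) (x : X), is_plot (fun _ : U => x);
  is_plot_comp : forall n m (U : domain R n) (V : domain R m)
      (P : U -> X) (f : V -> U),
    is_plot P -> smooth_between f -> is_plot (P \o f);
  is_plot_local : forall n (U : domain R n) (P : U -> X)
      (C : set (domain R n)) (CU : forall A, C A -> A `<=` U),
    \bigcup_(A in C) (A : set _) = U ->
    (forall A (CA : C A), is_plot (P \o inclusion (CU A CA))) ->
    is_plot P }.

Definition diff_smooth (X Y : Type) (DX : diffeology X) (DY : diffeology Y)
    (f : X -> Y) :=
  forall n (U : domain R n) (P : U -> X), is_plot DX P -> is_plot DY (f \o P).

Definition euclidean_diffeology p : diffeology 'rV[R]_p.
Proof.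
exists (fun n (U : domain R n) (P : U -> 'rV[R]_p) => smooth_map P).
- by move=> n U x; exact: smooth_map_cst.
- by move=> n m U V P f hP hf; exact: smooth_map_comp.
- by move=> n U P C CU; exact: smooth_map_local.
Defined.

Definition domain_diffeology p (D : domain R p) : diffeology D.
Proof.
exists (fun n (U : domain R n) (P : U -> D) => smooth_between P).
- by move=> n U x; exact: smooth_map_cst.
- by move=> n m U V P f hP hf; exact: (smooth_map_comp hf hP).
- by move=> n U P C CU covU h; exact: (smooth_map_local covU h).
Defined.

Definition prod_diffeology X Y (DX : diffeology X) (DY : diffeology Y) :
  diffeology (X * Y).
Proof.
exists (fun n (U : domain R n) (P : U -> X * Y) =>
  is_plot DX (fst \o P) /\ is_plot DY (snd \o P)).
- by move=> n U x; split; exact: is_plot_cst.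
- by move=> n m U V P f [h1 h2] hf; split; [exact: (is_plot_comp h1 hf)|exact: (is_plot_comp h2 hf)].
- move=> n U P C CU covU h.
  by split; apply: (is_plot_local covU (CU := CU)) => A CA;
    have [h1 h2] := h A CA.
Defined.

Record plot (X : Type) (D : diffeology X) := Plot {
  pdim : nat;
  pdom : domain R pdim;
  pmap :> pdom -> X;
  plotP : is_plot D pmap }.

Section Plots.
Context (X : Type) (D : diffeology X).

Definition plot_comp (P : plot D) m (V : domain R m) (f : V -> pdom P)
    (hf : smooth_between f) : plot D :=
  Plot (is_plot_comp (plotP P) hf).

Lemma smooth_is_plot n (U : domain R n) (f : U -> X) :
  diff_smooth (domain_diffeology U) D f -> is_plot D f.
Proof.
move=> /(_ n U id); apply.
by apply: (@smooth_map_eq _ _ _ _ _ id) => //; exact: smooth_on_id.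
Qed.

Definition plot_of_smooth n (U : domain R n) (f : U -> X)
    (hf : diff_smooth (domain_diffeology U) D f) : plot D :=
  Plot (smooth_is_plot hf).

(* The disjoint union of the U_P x R^n x R^n over all plots P, and the
   relation generated by the arrows of the category of plots. *)
Definition pre_T2 :=
  {P : plot D & (pdom P * 'rV[R]_(pdim P) * 'rV[R]_(pdim P))%type}.

Inductive T2_step : pre_T2 -> pre_T2 -> Prop :=
  T2Step (P Q : plot D) (h : pdom P -> pdom Q) (hh : smooth_between h)
    (Qh : Q \o h = P) (r : pdom P) (v w : 'rV[R]_(pdim P)) :
  T2_step (existT _ P (r, v, w))
          (existT _ Q (h r, v *m Jac h r, w *m Jac h r)).

Definition T2_eq : pre_T2 -> pre_T2 -> Prop := clos_refl_sym_trans _ T2_step.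

Definition T2 := {c : set pre_T2 | exists p, c = [set q | T2_eq p q]}.

Definition T2_pi (p : pre_T2) : T2 :=
  exist _ [set q | T2_eq p q] (ex_intro _ p erefl).

Definition T2_class (P : plot D) (r : pdom P) (v w : 'rV[R]_(pdim P)) : T2 :=
  T2_pi (existT _ P (r, v, w)).

Definition T2_in (P : plot D)
    (x : pdom P * 'rV[R]_(pdim P) * 'rV[R]_(pdim P)) : T2 :=
  T2_class x.1.1 x.1.2 x.2.

Definition frame_diffeology (P : plot D) :
    diffeology (pdom P * 'rV[R]_(pdim P) * 'rV[R]_(pdim P)) :=
  prod_diffeology
    (prod_diffeology (domain_diffeology (pdom P)) (euclidean_diffeology _))
    (euclidean_diffeology _).

(* The finest diffeology for which all the structural maps are smooth. *)
Definition T2_diffeology : diffeology T2.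
Proof.
exists (fun n (U : domain R n) (p : U -> T2) => forall E : diffeology T2,
  (forall P, diff_smooth (frame_diffeology P) E (@T2_in P)) -> is_plot E p).
- by move=> n U x E _; exact: is_plot_cst.
- by move=> n m U V p f hp hf E hE; apply: is_plot_comp => //; exact: hp.
- move=> n U p C CU covU h E hE.
  by apply: (is_plot_local covU (CU := CU)) => A CA; exact: h.
Defined.


Lemma T2_in_smooth P : diff_smooth (frame_diffeology P) T2_diffeology (@T2_in P).
Proof. by move=> n U p hp E; apply. Qed.

Lemma T2_pi_eq p q : T2_eq p q -> T2_pi p = T2_pi q.
Proof.
move=> pq; apply: eq_exist; apply/seteqP; split=> r /= h.
  by apply: rst_trans h; exact: rst_sym.
exact: rst_trans h.
Qed.

Lemma T2_in_step (P Q : plot D) (h : pdom P -> pdom Q) r v w :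
  smooth_between h -> Q \o h = P ->
  T2_class (h r) (v *m Jac h r) (w *m Jac h r) = T2_class (P := P) r v w.
Proof. by move=> hh Qh; apply/esym/T2_pi_eq; apply: rst_step; exact: T2Step. Qed.

(* Together with [T2_in_smooth] and [T2_in_step]: [T2], with its diffeology,
   is the colimit in the category of diffeological spaces. *)
Lemma T2_colimit (Y : Type) (DY : diffeology Y)
    (phi : forall P : plot D,
      pdom P * 'rV[R]_(pdim P) * 'rV[R]_(pdim P) -> Y) :
  (forall P, diff_smooth (frame_diffeology P) DY (phi P)) ->
  (forall (P Q : plot D) (h : pdom P -> pdom Q) r v w,
    smooth_between h -> Q \o h = P ->
    phi Q (h r, v *m Jac h r, w *m Jac h r) = phi P (r, v, w)) ->
  exists! F : T2 -> Y, diff_smooth T2_diffeology DY F /\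
    forall P x, F (T2_in x) = phi P x.
Proof.
move=> sphi cphi.
pose ev (p : pre_T2) := phi (projT1 p) (projT2 p).
have evE p q : T2_eq p q -> ev p = ev q.
  elim=> {p q} [_ _ [P Q h hh Qh r v w]|//|p q _ //|p q r _ -> _ //].
  by rewrite /ev /= cphi.
pose rep (c : T2) := sval (cid (svalP c)).
have repE p : T2_eq p (rep (T2_pi p)).
  rewrite /rep; case: cid => q /= /seteqP[_ /(_ q)]; apply; exact: rst_refl.
pose F c := ev (rep c).
have FE P x : F (T2_in x) = phi P x.
  by rewrite /F -(evE _ _ (repE _)) /ev /=; case: x => -[].
exists F; split.
  split=> // n U p hp.
  have plF : exists E : diffeology T2,
      forall m (V : domain R m) (q : V -> T2),
      is_plot E q <-> is_plot DY (F \o q).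
    unshelve eexists (Diffeology (is_plot :=
      fun n (U : domain R n) (p : U -> T2) => is_plot DY (F \o p)) _ _ _).
    - by move=> m V x; exact: is_plot_cst.
    - by move=> m k V W q f hq hf; exact: (is_plot_comp hq hf).
    - by move=> m V q C CU cov h; exact: (is_plot_local cov h).
    - by [].
  have [E EF] := plF; apply/EF/hp => P m V q hq; apply/EF.
  rewrite (_ : F \o _ = phi P \o q); first exact: sphi.
  by apply/funext => z /=; rewrite FE.
move=> G [_ GE]; apply/funext => c; have [[P [[r v] w]] cE] := svalP c.
have -> : c = T2_in (P := P) (r, v, w).
  by case: c cE => c ? /= cE; exact: eq_exist.
by rewrite FE GE.
Qed.

(* A covariant 2-tensor on a domain, as a bilinear form at each point;
   smoothness is that of its coefficients in the canonical basis. *)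
Definition domain_tensor2 n (U : domain R n) :=
  U -> 'rV[R]_n -> 'rV[R]_n -> R.

Definition bilinear_tensor n (U : domain R n) (T : domain_tensor2 U) :=
  forall r : U, (forall w, scalar (fun v => T r v w)) /\
                (forall v, scalar (fun w => T r v w)).

Definition smooth_tensor n (U : domain R n) (T : domain_tensor2 U) :=
  bilinear_tensor T /\
  forall i j : 'I_n,
    smooth_map (fun r => T r (delta_mx 0 i) (delta_mx 0 j) : R).

Definition symmetric_tensor n (U : domain R n) (T : domain_tensor2 U) :=
  forall r v w, T r v w = T r w v.

Definition pullback n m (V : domain R m) (U : domain R n) (f : V -> U)
    (T : domain_tensor2 U) : domain_tensor2 V :=
  fun s v w => T (f s) (v *m Jac f s) (w *m Jac f s).

Definition metric_on (g : T2 -> R) (P : plot D) : domain_tensor2 (pdom P) :=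
  fun r v w => g (T2_class r v w).
Arguments metric_on g P : clear implicits.

Definition weak_riemannian_metric (g : T2 -> R) :=
  forall P : plot D,
    [/\ smooth_tensor (metric_on g P),
        symmetric_tensor (metric_on g P) &
        forall r v, 0 <= metric_on g P r v v].

Record covariant_tensor2 := CovariantTensor2 {
  ctensor :> forall P : plot D, domain_tensor2 (pdom P);
  ctensor_smooth : forall P, smooth_tensor (@ctensor P);
  ctensor_natural : forall (P : plot D) m (V : domain R m) (f : V -> pdom P)
    (hf : smooth_between f),
    @ctensor (plot_comp hf) = pullback f (@ctensor P) }.
Arguments ctensor _ P : clear implicits.

Definition symmetric_covariant (nu : covariant_tensor2) :=
  forall P, symmetric_tensor (nu P).

(* [const_mx 1] is the canonical basis vector of the tangent space of the
   line, which is modelled by ['rV_1]. *)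
Definition positive_covariant (nu : covariant_tensor2) :=
  forall (gamma : full_domain R 1 -> X)
    (hgamma : diff_smooth (domain_diffeology (full_domain R 1)) D gamma)
    (t : full_domain R 1),
    0 <= nu (plot_of_smooth hgamma) t (const_mx 1) (const_mx 1).

End Plots.
End Diffeology.

(* Main.v *)
Require Import Defs.
From mathcomp Require Import all_boot all_order all_algebra.
From mathcomp Require Import all_classical all_reals all_analysis.
From Stdlib Require Import Relation_Operators.

(** By naturality a covariant 2-tensor is a cocone on the diagram whose colimit
    is [T2], so tensors and fibrewise tensorial functions on [T2] correspond.
    The positivity conditions agree because every tangent vector [v] at [r] in
    a domain is, up to a positive factor [c], the velocity at [0] of a path
    defined on the whole line and staying in the domain:
    [t |-> r + c sin t v] for small [c]. *)

Set Implicit Arguments.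
Unset Strict Implicit.
Unset Printing Implicit Defensive.

Import Order.TTheory GRing.Theory Num.Theory.
Import numFieldNormedType.Exports.

Local Open Scope classical_set_scope.
Local Open Scope ring_scope.

Section SinePath.
Context {R : realType}.

Lemma is_diff_coord0 (x : 'rV[R]_1) :
  is_diff x (fun y : 'rV[R]_1 => y 0 0) (fun y : 'rV[R]_1 => y 0 0).
Proof.
split; first exact: differentiable_coord.
apply/funext => v; rewrite -deriveE; last exact: differentiable_coord.
rewrite -[LHS]/('D_v (fun y : 'rV[R]_1 => (id y) 0 0) x).
have := derive_mx (M := id) (@derivable_id _ _ x v).
by rewrite derive_id => /matrixP/(_ 0 0); rewrite mxE.
Qed.

(** The chain rule through the linear coordinate of ['rV_1]; it carries one-variable derivatives
    over to the line as modelled here. *)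
Lemma derivable_comp_coord0 (f df : R -> R) (x v : 'rV[R]_1) :
  (forall t : R, is_derive t 1 f (df t)) ->
  differentiable (fun y : 'rV[R]_1 => f (y 0 0)) x /\
  'D_v (fun y : 'rV[R]_1 => f (y 0 0)) x = v 0 0 * df (x 0 0).
Proof.
move=> fdf; have [dc cE] := is_diff_coord0 x.
have df0 : differentiable f (x 0 0).
  by apply/derivable1_diffP; have [] := fdf (x 0 0).
have dcomp : differentiable (f \o (fun y : 'rV[R]_1 => y 0 0)) x.
  exact: differentiable_comp.
split=> //; rewrite -[LHS]/('D_v (f \o (fun y : 'rV[R]_1 => y 0 0)) x).
rewrite deriveE// diff_comp//= cE.
have -> : v 0 0 = v 0 0 *: (1 : R) by rewrite /GRing.scale/= mulr1.
rewrite linearZ/= -deriveE//; congr (_ * _).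
  by rewrite /GRing.scale/= mulr1.
by have [] := fdf (x 0 0).
Qed.

(** Each directional derivative of one function is a constant times the other, so a joint induction
    on [k] closes. *)
Lemma classC_sin_cos k (U : set 'rV[R]_1) : open U ->
  classC k U (fun y : 'rV[R]_1 => sin (y 0 0)) /\
  classC k U (fun y : 'rV[R]_1 => cos (y 0 0)).
Proof.
move=> oU; elim: k => [|k [IHs IHc]].
  split=> x _; apply: differentiable_continuous.
    by have [] := derivable_comp_coord0 x 0 (@is_derive_sin R).
  by have [] := derivable_comp_coord0 x 0 (@is_derive_cos R).
split; split=> [x _|v].
- by have [] := derivable_comp_coord0 x 0 (@is_derive_sin R).
- rewrite (_ : 'D_v _ = (fun=> v 0 0) * (fun y : 'rV[R]_1 => cos (y 0 0))).
    by apply: classC_mul => //; exact: classC_cst.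
  by apply/funext => x; have [_ ->] := derivable_comp_coord0 x v (@is_derive_sin R).
- by have [] := derivable_comp_coord0 x 0 (@is_derive_cos R).
- rewrite (_ : 'D_v _ = (fun=> - v 0 0) * (fun y : 'rV[R]_1 => sin (y 0 0))).
    by apply: classC_mul => //; exact: classC_cst.
  apply/funext => x; have [_ ->] := derivable_comp_coord0 x v (@is_derive_cos R).
  by rewrite mulrN -mulNr.
Qed.

(** Sine is smooth on the whole line, bounded by 1, and has value 0 and derivative 1 at 0: the path
    stays near [a], and leaves it at time 0 with velocity [b]. *)
Definition sine_path n (a b : 'rV[R]_n) (t : 'rV[R]_1) : 'rV[R]_n :=
  a + sin (t 0 0) *: b.

Lemma smooth_sine_path n (a b : 'rV[R]_n) (U : set 'rV[R]_1) :
  open U -> smooth_on U (sine_path a b).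
Proof.
move=> oU k; apply/classC_coordP => // i.
rewrite (_ : (fun x => _) =
  (fun=> a 0 i) + (fun x : 'rV[R]_1 => sin (x 0 0)) * (fun=> b 0 i)).
  apply: classC_add => //; first exact: classC_cst.
  apply: classC_mul => //; [by have [] := classC_sin_cos k oU|exact: classC_cst].
by apply/funext => x; rewrite /sine_path !mxE.
Qed.

Lemma derive_sine_path n (a b : 'rV[R]_n) :
  'D_(const_mx 1) (sine_path a b) (0 : 'rV[R]_1) = b.
Proof.
have dp : differentiable (sine_path a b) (0 : 'rV[R]_1).
  by have [/(_ 0 I)] := smooth_sine_path a b openT 1.
rewrite derive_mx; last exact: diff_derivable.
apply/rowP => i; rewrite mxE.
have [ds Ds] := derivable_comp_coord0 (0 : 'rV[R]_1) (const_mx 1) (@is_derive_sin R).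
rewrite (_ : (fun x => _) =
  cst (a 0 i) + b 0 i *: (fun x : 'rV[R]_1 => sin (x 0 0))); last first.
  by apply/funext => x; rewrite /sine_path !mxE [RHS]/= mulrC.
rewrite deriveD; last 2 first.
- exact: derivable_cst.
- by apply: derivableZ; exact: diff_derivable.
rewrite derive_cst add0r deriveZ; last exact: diff_derivable.
by rewrite Ds !mxE cos0 /GRing.scale/= !mulr1.
Qed.

Lemma sine_path_small n (U : domain R n) (r : U) (v : 'rV[R]_n) :
  exists2 c : R, 0 < c & forall t, dom_set U (sine_path (val r) (c *: v) t).
Proof.
have /nbhs_ballP[e /= e0 eU] : nbhs (val r) U.
  by apply: open_nbhs_nbhs; split; [exact: dom_open|exact: dom_val].
have v1 : 0 < `|v| + 1 by rewrite ltr_wpDl.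
(* The displacement has norm at most [e * |v| / (|v| + 1) < e]; the summand 1 covers [v = 0]. *)
exists (e / (`|v| + 1)) => [|t]; first by rewrite divr_gt0.
apply: eU; rewrite -ball_normE /ball_/= /sine_path opprD addrA subrr sub0r.
rewrite normrN scalerA normrZ normrM.
apply: (@le_lt_trans _ _ (e / (`|v| + 1) * `|v|)).
  have c0 := divr_ge0 (ltW e0) (ltW v1).
  rewrite (ger0_norm c0) ler_wpM2r// ler_piMl//.
  by rewrite ler_norml sin_le1 sin_geN1.
by rewrite mulrAC ltr_pdivrMr// ltr_pM2l// ltrDl.
Qed.

End SinePath.

Section Correspondence.
Context {R : realType} {X : Type} {D : diffeology R X}.

Lemma covariant_tensor2_ext (nu mu : covariant_tensor2 D) :
  (forall P r v w, nu P r v w = mu P r v w) -> nu = mu.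
Proof.
case: nu mu => [nu s n] [mu s' n'] /= numu.
have E : nu = mu.
  apply: functional_extensionality_dep => P.
  by do 3!apply/funext => ?; exact: numu.
by case: _ / E s' n' {numu} => s' n'; congr CovariantTensor2; exact: Prop_irrelevance.
Qed.

(** Naturality concerns plots of the form [plot_comp]; here it is transferred to arbitrary arrows of
    the category of plots, making [nu] a cocone. *)
Lemma ctensor_step (nu : covariant_tensor2 D) (P Q : plot D)
    (h : pdom P -> pdom Q) r v w :
  smooth_between h -> Q \o h = P ->
  nu Q (h r) (v *m Jac h r) (w *m Jac h r) = nu P r v w.
Proof.
move=> hh QhP.
have /(congr1 (fun T => T r v w)) := ctensor_natural nu hh; rewrite /pullback => <-.
(* Once [P] is opened, its map can be replaced by [Q \o h]; the two plots then differ only in their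
   proofs. *)
case: P h r v w hh QhP => n U P plP /= h r v w hh QhP; rewrite /plot_comp/=.
case: _ / QhP plP => plP.
by rewrite (Prop_irrelevance plP (is_plot_comp (plotP Q) hh)).
Qed.

Lemma T2_classP (c : T2 D) :
  exists P (r : pdom P) (v w : 'rV[R]_(pdim P)), c = T2_class r v w.
Proof.
have [[P [[r v] w]] cE] := svalP c; exists P, r, v, w.
by case: c cE => c ? /= cE; exact: eq_exist.
Qed.

Definition tensor_of_metric (g : T2 D -> R) (gm : weak_riemannian_metric g) :
  covariant_tensor2 D.
Proof.
exists (fun P => metric_on (P := P) g) => [P|P m V f hf].
  by have [] := gm P.
apply/funext => r; apply/funext => v; apply/funext => w.
(* [f] is an arrow from [P \o f] to [P], so both sides evaluate [g] at the same class. *)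
rewrite /pullback /metric_on; congr g; apply/esym.
exact: (@T2_in_step _ _ D (plot_comp hf) P f).
Defined.

(** The representative [p] of the class [c] is obtained by choice. *)
Definition metric_of_tensor (nu : covariant_tensor2 D) (c : T2 D) : R :=
  let p := sval (cid (svalP c)) in
  nu (projT1 p) (projT2 p).1.1 (projT2 p).1.2 (projT2 p).2.

Lemma metric_of_tensorE (nu : covariant_tensor2 D) (P : plot D) (r : pdom P)
    (v w : 'rV[R]_(pdim P)) :
  metric_of_tensor nu (T2_class r v w) = nu P r v w.
Proof.
pose ev (p : pre_T2 D) :=
  nu (projT1 p) (projT2 p).1.1 (projT2 p).1.2 (projT2 p).2.
(* Invariance under the generating arrows extends to the equivalence closure, so the chosen
   representative does not matter. *)
have evE p q : T2_eq p q -> ev p = ev q.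
  elim=> {p q} [_ _ [A B h hh Bh s a b]|//|p q _ //|p q s _ -> _ //].
  by rewrite /ev/= ctensor_step.
rewrite /metric_of_tensor; case: cid => p /= /seteqP[_ /(_ p)] pE.
by rewrite -[LHS]/(ev p) -(evE _ _ (pE (rst_refl _ _ p))).
Qed.

Lemma positive_covariant_plot (nu : covariant_tensor2 D) (P : plot D)
    (r : pdom P) (v : 'rV[R]_(pdim P)) :
  positive_covariant nu -> 0 <= nu P r v v.
Proof.
move=> nupos; have [c c0 cP] := sine_path_small r v.
pose sp := sine_path (val r) (c *: v).
pose h (t : full_domain R 1) : pdom P := exist _ (sp (val t)) (mem_set (cP (val t))).
have hh : smooth_between h.
  by apply: (@smooth_map_eq _ _ _ _ _ sp) => //; exact/smooth_sine_path/openT.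
have hgamma : diff_smooth (domain_diffeology (full_domain R 1)) D (P \o h).
  move=> n U q hq; apply: (@is_plot_comp _ _ D _ _ _ _ (P \o h) q) => //.
  exact: (@is_plot_comp _ _ D _ _ _ _ P h (plotP P)).
pose t0 : full_domain R 1 := exist _ 0 (mem_set I).
have := nupos _ hgamma t0.
(* Seen as an arrow from [P \o h] to [P], [h] moves the positivity along the path to [nu P] at the
   velocity of [h]. *)
rewrite -(@ctensor_step _ (plot_of_smooth hgamma) P h t0)//.
have -> : h t0 = r by apply: val_inj; rewrite /= /sp /sine_path mxE sin0 scale0r addr0.
have -> : const_mx 1 *m Jac h t0 = c *: v.
  (* The domain is the whole line, so the default value of [extend] never occurs. *)
  rewrite /Jac (_ : extend _ = sp); last first.
    by apply/funext => x; rewrite -[x]/(val (exist _ x (mem_set I) : full_domain R 1)) extendE.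
  rewrite /jacobian mul_rV_lin1 -deriveE ?derive_sine_path//.
  by have [/(_ 0 I)] := smooth_sine_path (val r) (c *: v) openT 1.
have [bil _] := ctensor_smooth nu P.
have [/(_ (c *: v))/scalable_linear l1 /(_ v)/scalable_linear l2] := bil r.
(* Bilinearity pulls out two factors [c], which are positive and cancel. *)
rewrite l1 l2 /=.
by rewrite !pmulr_rge0.
Qed.

Lemma metric_of_tensorP (nu : covariant_tensor2 D) :
  symmetric_covariant nu /\ positive_covariant nu ->
  weak_riemannian_metric (metric_of_tensor nu).
Proof.
move=> [nusym nupos] P.
have -> : metric_on (P := P) (metric_of_tensor nu) = nu P.
  by do 3!apply/funext => ?; exact: metric_of_tensorE.
split; [exact: ctensor_smooth|exact: nusym|].
by move=> r v; exact: positive_covariant_plot.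
Qed.

Lemma tensor_of_metricP (g : T2 D -> R) (gm : weak_riemannian_metric g) :
  symmetric_covariant (tensor_of_metric gm) /\
  positive_covariant (tensor_of_metric gm).
Proof.
split=> [P|gamma hgamma t]; first by have [] := gm P.
by have [_ _] := gm (plot_of_smooth hgamma); exact.
Qed.

End Correspondence.

Theorem proposition3p5 (R : realType) (X : Type) (D : diffeology R X) :
  exists f : {g : T2 D -> R | weak_riemannian_metric g} ->
             {nu : covariant_tensor2 D |
               symmetric_covariant nu /\ positive_covariant nu},
    bijective f /\
    forall (g : {g : T2 D -> R | weak_riemannian_metric g})
      (P : plot D) (r : pdom P) (v w : 'rV[R]_(pdim P)),
      proj1_sig (f g) P r v w = proj1_sig g (T2_class r v w).
Proof.
exists (fun g => exist _ (tensor_of_metric (proj2_sig g))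
  (tensor_of_metricP (proj2_sig g))); split=> //.
exists (fun nu => exist _ (metric_of_tensor (proj1_sig nu))
  (metric_of_tensorP (proj2_sig nu))).
- move=> [g gm]; apply: eq_exist; apply/funext => c.
  (* Every point of the colimit is a class, so agreement on classes suffices. *)
  have [P [r [v [w ->]]]] := T2_classP c.
  by rewrite metric_of_tensorE.
- move=> [nu nuP]; apply: eq_exist; apply: covariant_tensor2_ext => P r v w.
  exact: metric_of_tensorE.
Qed.
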